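(* Let $D\ge 1$, $\alpha\ge 1$ and $\beta>0$ be constants. There is a constant $c>0$, depending only on $D,\alpha,\beta$, such that the following holds. Let $H=-\sum_{a=1}^M G_a$ be a local frustration-free stabilizer Hamiltonian on the $D$-dimensional periodic lattice $\Lambda=\mathbb{Z}_L^D$ which obeys both topological order conditions with length scale $L_{tqo}\ge L^\beta$ and obeys the no-strings rule with constant $\alpha$. Let $S$ be a neutral cluster of defects containing a charged cluster $S'\subseteq S$ of diameter $r$ such that there are no other defects (of $S$) within distance $R$ from $S'$. If $r+R<L_{tqo}$, then the energy barrier for creating $S$ from the vacuum is at least $c\log R$; that is, for every Pauli operator $E$ creating $S$ from the vacuum and every error path implementing $E$, at least one of the intermediate states has more than $c\log R$ defects.
   Context: **Lattice.** $\Lambda=\mathbb{Z}_L^D$ is the cubic lattice of linear size $L$ with periodic boundary conditions, with a finite number of qubits at each site; distances and diameters use the $\ell_\infty$ metric. An axis-parallel cube of linear size $\ell$ is a product of $D$ intervals of $\ell$ consecutive coordinates (so $\Lambda$ has linear size $L$). An elementary cube is a unit cell of the lattice (its $2^D$ vertices); it has diameter $1$. $\mathcal{B}_r(A)$ is the set of all points at distance at most $r$ from $A$. **Stabilizer Hamiltonian.** $H=-\sum_{a=1}^M G_a$, where the $G_a$ are pairwise commuting multi-qubit Pauli operators (tensor products of $I,X,Y,Z$ with sign $\pm1$), $G_a^2=I$, each acting non-trivially only on qubits at the vertices of one elementary cube (several generators per cube are allowed). No translation invariance is assumed. $\mathcal{G}=\langle G_1,\dots,G_M\rangle$ is the stabilizer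 group; its elements are stabilizers. Frustration-freeness: $-I\notin\mathcal{G}$, so ground states (the ''vacuum'') $\psi_0$ satisfy $G_a\psi_0=\psi_0$ for all $a$. The support of a Pauli operator is the set of sites/qubits on which it acts non-trivially. For a Pauli operator $E$, the defects of $E\psi_0$ (created by applying $E$ to the vacuum) are the generators $G_a$ anticommuting with $E$; each defect is located at the elementary cube of its generator. **Topological order (length scale $L_{tqo}$).** (1) If a Pauli operator $E$ creates no defects when applied to the vacuum and its support can be enclosed by a cube of linear size $L_{tqo}$, then $E$ is a stabilizer. (2) A cluster (set) of defects $S$ is *neutral* if it can be created from the vacuum, without any other defects, by a Pauli operator whose support can be enclosed by a cube of linear size $L_{tqo}$; otherwise $S$ is *charged*. The condition: if $S$ is neutral and $C_{min}(S)$ is the smallest cube enclosing $S$, then $S$ can be created from the vacuum by a Pauli operator supported on $\mathcal{B}_1(C_{min}(S))$. **No-strings rule (constant $\alpha$).** Let $E$ be a Pauli operator whose support can be enclosed by a cube of linear size $L_{tqo}$, let $S$ be the cluster of defects it creates from the vacuum, and let $A_1,A_2$ be disjoint cubes of the same linear size $\rho$. $E$ is a *logical string segment* with anchor regions $A_1,A_2$ iff $S$ is contained in $A_1\cup A_2$ (equivalently $E$ commutes with all generators located outside $A_1\cup A_2$). It has aspect ratio $\alpha'$ iff the distance between $A_1$ and $A_2$ is at least $\alpha'\rho$. It is *trivial* iff the cluster of defects contained inside any anchor region is neutral. The rule: all logical string segments with aspect ratio greater than $\alpha$ are trivial. **Error path and energy barrier.** An error path implementing a Pauli operator $E$ is a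 finite sequence $E_1,\dots,E_T$ (of arbitrary length) of single-qubit Pauli operators ($X$, $Y$ or $Z$ on one qubit; repetitions allowed) with $E=E_T\cdots E_1$. The intermediate states are $\psi(t)=E_t\cdots E_1\psi_0$, with $\psi_0$ a ground state. A cluster $S$ has energy barrier $\omega$ iff for every Pauli operator $E$ that creates $S$ from the vacuum and every error path implementing $E$, at least one intermediate state has more than $\omega$ defects.
   Formalization: The diameter r of S' is read as its linear extent (side of the smallest enclosing cube minus one), not the torus metric diameter; they differ only for clusters winding around the torus, possible when L_tqo exceeds about L/2, where the metric version is false. *)

(* Defs.v *)
From HB Require Import structures.
From mathcomp Require Import all_boot all_order all_algebra all_fingroup.
From mathcomp Require Import zify.
From mathcomp Require Import reals exp.

Set Implicit Arguments.
Unset Strict Implicit.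
Unset Printing Implicit Defensive.

Import Order.TTheory GRing.Theory Num.Theory.

Inductive pauli1 := PI | PX | PY | PZ.

Definition pauli1_code (p : pauli1) : bool * bool :=
  match p with
  | PI => (false, false) | PX => (true, false)
  | PY => (true, true) | PZ => (false, true)
  end.

Definition pauli1_decode (b : bool * bool) : pauli1 :=
  match b with
  | (false, false) => PI | (true, false) => PX
  | (true, true) => PY | (false, true) => PZ
  end.

Lemma pauli1_codeK : cancel pauli1_code pauli1_decode.
Proof. by case. Qed.

HB.instance Definition _ := Equality.copy pauli1 (can_type pauli1_codeK).
HB.instance Definition _ := Choice.copy pauli1 (can_type pauli1_codeK).
HB.instance Definition _ := Countable.copy pauli1 (can_type pauli1_codeK).
HB.instance Definition _ := Finite.copy pauli1 (can_type pauli1_codeK).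

(* As matrices, p * q = i ^ (phase1 p q) * (mul1 p q) with i the imaginary
   unit: XY = iZ, YZ = iX, ZX = iY, and -i for the reversed products. *)
Definition mul1 (p q : pauli1) : pauli1 :=
  match p, q with
  | PI, r | r, PI => r
  | PX, PX | PY, PY | PZ, PZ => PI
  | PX, PY | PY, PX => PZ
  | PY, PZ | PZ, PY => PX
  | PZ, PX | PX, PZ => PY
  end.

Definition phase1 (p q : pauli1) : 'Z_4 :=
  match p, q with
  | PX, PY | PY, PZ | PZ, PX => 1%R
  | PY, PX | PZ, PY | PX, PZ => (-1)%R
  | _, _ => 0%R
  end.

(* (k, f) stands for the operator i ^ k * (tensor product of the f q), with
   k modulo 4. *)
Definition pauli (Q : finType) : Type := ('Z_4 * {ffun Q -> pauli1})%type.

HB.instance Definition _ (Q : finType) :=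
  Finite.copy (pauli Q) ('Z_4 * {ffun Q -> pauli1})%type.

Section PauliGroup.
Variable Q : finType.

Definition pauli_one : pauli Q := (0%R, [ffun=> PI]).

Definition pauli_inv (E : pauli Q) : pauli Q := ((- E.1)%R, E.2).

Definition pauli_mul (E F : pauli Q) : pauli Q :=
  ((E.1 + F.1 + \sum_q phase1 (E.2 q) (F.2 q))%R,
   [ffun q => mul1 (E.2 q) (F.2 q)]).

Lemma pauli_mulA : associative pauli_mul.
Proof.
move=> [k f] [l g] [m h]; congr pair => /=; last first.
  by apply/ffunP => q; rewrite !ffunE; case: (f q) (g q) (h q) => [] [] [].
have cocycle : (\sum_q phase1 (g q) (h q)
      + \sum_q phase1 (f q) ([ffun q => mul1 (g q) (h q)] q)
    = \sum_q phase1 (f q) (g q)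
      + \sum_q phase1 ([ffun q => mul1 (f q) (g q)] q) (h q))%R.
  rewrite -!big_split /=; apply: eq_bigr => q _; rewrite !ffunE.
  by case: (f q) (g q) (h q) => [] [] []; apply/val_inj.
rewrite -!addrA; congr (_ + (_ + _))%R.
by rewrite cocycle addrCA.
Qed.

Lemma pauli_mul1 : left_id pauli_one pauli_mul.
Proof.
move=> [k f]; congr pair => /=; last first.
  by apply/ffunP => q; rewrite !ffunE.
by rewrite big1 ?addr0 ?add0r // => q _; rewrite ffunE.
Qed.

Lemma pauli_mulV : left_inverse pauli_one pauli_inv pauli_mul.
Proof.
move=> [k f]; congr pair => /=; last first.
  by apply/ffunP => q; rewrite !ffunE; case: (f q).
by rewrite addNr add0r big1 // => q _; case: (f q).
Qed.

End PauliGroup.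

HB.instance Definition _ (Q : finType) :=
  Finite_isGroup.Build (pauli Q)
    (@pauli_mulA Q) (@pauli_mul1 Q) (@pauli_mulV Q).

Local Open Scope group_scope.

Section PauliOperators.
Variable Q : finType.

Definition minus_one : pauli Q := (2%:R%R, [ffun=> PI]).

Definition anticommute (E F : pauli Q) : bool := E * F == minus_one * (F * E).

Definition qsupport (E : pauli Q) : {set Q} := [set q | E.2 q != PI].

Definition single_pauli (q : Q) (p : pauli1) : pauli Q :=
  (0%R, [ffun q' => if q' == q then p else PI]).

Definition is_single_qubit (E : pauli Q) : bool :=
  [exists q, exists p, (p != PI) && (E == single_pauli q p)].

(* For s = [:: E_1; ...; E_T], the operator E_T ... E_1. *)
Definition path_prod (s : seq (pauli Q)) : pauli Q := \prod_(e <- rev s) e.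

Definition error_path (E : pauli Q) (s : seq (pauli Q)) : Prop :=
  all is_single_qubit s /\ path_prod s = E.

End PauliOperators.

Notation site D L := {ffun 'I_D -> 'I_L}.

Section Lattice.
Variables D L : nat.
Implicit Types (x y : site D L) (A : {set site D L}).

Definition cdist (a b : 'I_L) : nat :=
  minn ((a + (L - b)) %% L) ((b + (L - a)) %% L).

Definition sdist x y : nat := \max_(i < D) cdist (x i) (y i).

Definition ball (r : nat) A : {set site D L} :=
  [set y : site D L | [exists x in A, sdist x y <= r]].

(* Sites x + v with v in {0, ..., l - 1} ^ D, coordinates modulo L; this is the
   whole lattice as soon as L <= l. *)
Definition cube x (l : nat) : {set site D L} :=
  [set y : site D L | [forall i, (y i + (L - x i)) %% L < l]].

Definition enclosable (l : nat) A : Prop := exists x, A \subset cube x l.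

(* A smallest enclosing cube need not be unique. *)
Definition smallest_cube (x : site D L) (l : nat) A : Prop :=
  A \subset cube x l /\ (forall l', enclosable l' A -> l <= l').

(* The l_infinity diameter, read as the linear extent of the set: the smallest
   enclosing cube has r.+1 sites per side.  By has_diameter_sdist below this is
   the largest distance between two points of A when that distance is less than
   L / 3.  The two notions differ only for sets winding around the torus: three
   points spread evenly along a cycle are at distance about L / 3 from each
   other, although no cube of linear size less than about 2L / 3 encloses
   them. *)
Definition has_diameter A (r : nat) : Prop := exists x, smallest_cube x r.+1 A.

Lemma modsub a c : a < L -> c < L ->
  (a + (L - c)) %% L = if c <= a then a - c else a + L - c.
Proof.
move=> aL cL; case: leqP => ac; last by rewrite modn_small; lia.
by rewrite (_ : a + (L - c) = a - c + L) ?modnDr ?modn_small; lia.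
Qed.

Lemma modadd a b : a < L -> b < L ->
  (a + b) %% L = if a + b < L then a + b else a + b - L.
Proof.
move=> aL bL; case: ltnP => ab; first by rewrite modn_small.
by rewrite -{1}(subnK ab) modnDr modn_small; lia.
Qed.

Lemma lift_le (a c : 'I_L) r : cdist c a <= r -> 3 * r < L ->
  (a + (L - c) + r) %% L <= 2 * r.
Proof.
move: (ltn_ord a) (ltn_ord c); rewrite /cdist => aL cL.
rewrite !modsub // -modnDml modsub // geq_min => h rL.
move: h; case: (leqP a c) => ?; case: (leqP c a) => ? h.
all: rewrite modadd; [|lia|lia].
all: case: ifP; lia.
Qed.

Lemma lift_sub (a b c : 'I_L) r : r < L ->
  (a + (L - c) + r) %% L <= (b + (L - c) + r) %% L ->
  (b + (L - a)) %% L =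
  (b + (L - c) + r) %% L - (a + (L - c) + r) %% L.
Proof.
move: (ltn_ord a) (ltn_ord b) (ltn_ord c) => aL bL cL rL.
rewrite -!(modnDml (_ + (L - c))) !modsub //.
case: (leqP c a) => ?; case: (leqP c b) => ?; case: (leqP a b) => ?.
all: rewrite !modadd; [|lia|lia|lia|lia].
all: case: ifP => ?; case: ifP; lia.
Qed.

Lemma lift_close (a b c : 'I_L) r : 3 * r < L ->
  cdist c a <= r -> cdist c b <= r -> cdist a b <= r ->
  (a + (L - c) + r) %% L <= (b + (L - c) + r) %% L ->
  (b + (L - a)) %% L <= r.
Proof.
move=> rL ca cb ab le_ab; have rL' : r < L by lia.
have := lift_le ca rL; have := lift_le cb rL; have := lift_sub rL' le_ab.
set ua := (a + _ + r) %% L; set ub := (b + (L - c) + _) %% L.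
move: ab; rewrite /cdist geq_min; move: (ltn_ord a) (ltn_ord b) => aL bL.
rewrite !modsub //; case: (leqP a b) => ?; case: (leqP b a) => ?; lia.
Qed.

Lemma cdist_lt (a b c : 'I_L) l :
  (a + (L - c)) %% L < l -> (b + (L - c)) %% L < l -> cdist a b < l.
Proof.
move: (ltn_ord a) (ltn_ord b) (ltn_ord c); rewrite /cdist => aL bL cL.
rewrite !modsub // gtn_min; case: (leqP c a) => ?; case: (leqP c b) => ?.
all: case: (leqP a b) => ?; case: (leqP b a) => ?; lia.
Qed.

Lemma has_diameter_sdist A r : 0 < D ->
  (exists x y, [/\ x \in A, y \in A & sdist x y = r]) ->
  (forall x y, x \in A -> y \in A -> sdist x y <= r) ->
  3 * r < L -> has_diameter A r.
Proof.
move=> D0 [x0 [y0 [x0A y0A x0y0]]] leA rL.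
have coord x y i : x \in A -> y \in A -> cdist (x i) (y i) <= r.
  move=> xA yA; apply: leq_trans (leA _ _ xA yA).
  exact: (leq_bigmax (F := fun i => cdist (x i) (y i))).
pose u i (y : site D L) := (y i + (L - x0 i) + r) %% L.
pose low i := [arg min_(y < x0 in A) u i y].
have lowP i : low i \in A /\ forall y, y \in A -> u i (low i) <= u i y.
  by rewrite /low; case: arg_minnP.
pose x : site D L := [ffun i => low i i].
exists x; split.
  apply/subsetP => y yA; rewrite inE; apply/forallP => i; rewrite ffunE.
  have [zA zmin] := lowP i; have := zmin y yA.
  move: (low i) zA {zmin} => z zA; rewrite /u => uzy.
  rewrite ltnS.
  exact: (lift_close rL (coord _ _ i x0A zA) (coord _ _ i x0A yA)
                     (coord _ _ i zA yA) uzy).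
move=> l' [z /subsetP Az]; rewrite -x0y0.
have inz y i : y \in A -> (y i + (L - z i)) %% L < l'.
  by move=> /Az; rewrite inE => /forallP.
have l'0 : 0 < l' by apply: leq_ltn_trans (inz _ (Ordinal D0) x0A).
rewrite -(prednK l'0) ltnS; apply/bigmax_leqP => i _.
by rewrite -ltnS prednK //; apply: (@cdist_lt _ _ (z i)); apply: inz.
Qed.

End Lattice.

Record stabilizer_hamiltonian (D L : nat) := StabilizerHamiltonian {
  qubit : finType;
  qsite : qubit -> site D L;
  nb_gen : nat;
  gen : 'I_nb_gen -> pauli qubit;
  (* [gen_pos a] is the lowest corner of the elementary cube where the
     generator [gen a], hence the corresponding defect, is located. *)
  gen_pos : 'I_nb_gen -> site D L;
  gen_sign : forall a, (gen a).1 = 0%R \/ (gen a).1 = 2%:R%R;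
  gen_commute : forall a b, commute (gen a) (gen b);
  gen_local : forall a q, q \in qsupport (gen a) ->
    qsite q \in cube (gen_pos a) 2;
  frustration_free : minus_one qubit \notin <<[set gen a | a : 'I_nb_gen]>>
}.

Section Model.
Variables (D L : nat) (H : stabilizer_hamiltonian D L).
Implicit Types (E : pauli (qubit H)) (S : {set 'I_(nb_gen H)}).

Definition stabilizer_group : {group pauli (qubit H)} :=
  <<[set gen a | a : 'I_(nb_gen H)]>>%G.

(* Pauli operators matter up to an overall phase: -I has empty support and
   creates no defects, but is never in the stabilizer group. *)
Definition is_stabilizer E : Prop :=
  exists k : 'Z_4, (k, E.2) \in stabilizer_group.

Definition support E : {set site D L} := [set qsite q | q in qsupport E].

(* Clusters are sets of generators: several defects may share a cube. *)
Definition defects E : {set 'I_(nb_gen H)} :=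
  [set a | anticommute (gen a) E].

Definition gen_cube (a : 'I_(nb_gen H)) : {set site D L} := cube (gen_pos a) 2.

Definition sites S : {set site D L} := \bigcup_(a in S) gen_cube a.

Definition neutral (ltqo : nat) S : Prop :=
  exists E, defects E = S /\ enclosable ltqo (support E).

Definition charged (ltqo : nat) S : Prop := ~ neutral ltqo S.

Definition tqo1 (ltqo : nat) : Prop :=
  forall E, defects E = set0 -> enclosable ltqo (support E) -> is_stabilizer E.

(* The required cube is one of the smallest cubes enclosing S. *)
Definition tqo2 (ltqo : nat) : Prop :=
  forall S, neutral ltqo S ->
  exists x l, smallest_cube x l (sites S) /\
    exists E, defects E = S /\ support E \subset ball 1 (cube x l).

Definition logical_string_segment (ltqo : nat) E (A1 A2 : {set site D L})
    (rho : nat) : Prop :=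
  [/\ enclosable ltqo (support E),
      exists x, A1 = cube x rho,
      exists x, A2 = cube x rho,
      [disjoint A1 & A2]
    & sites (defects E) \subset A1 :|: A2].

Definition inside S (A : {set site D L}) : {set 'I_(nb_gen H)} :=
  [set a in S | gen_cube a \subset A].

Definition trivial_segment (ltqo : nat) E (A1 A2 : {set site D L}) : Prop :=
  neutral ltqo (inside (defects E) A1) /\ neutral ltqo (inside (defects E) A2).

Local Open Scope ring_scope.

Definition aspect_ratio (R : realType) (A1 A2 : {set site D L}) (rho : nat)
    (alpha : R) : Prop :=
  forall x y, x \in A1 -> y \in A2 -> alpha * rho%:R <= (sdist x y)%:R.

Definition no_strings (R : realType) (ltqo : nat) (alpha : R) : Prop :=
  forall E A1 A2 rho (alpha' : R),
    logical_string_segment ltqo E A1 A2 rho ->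
    aspect_ratio A1 A2 rho alpha' -> alpha < alpha' ->
    trivial_segment ltqo E A1 A2.

(* Every defect of S outside S' is at distance more than d from S'. *)
Definition isolated (R : realType) S S' (d : R) : Prop :=
  forall a x y, a \in S :\: S' -> x \in gen_cube a -> y \in sites S' ->
    d < (sdist x y)%:R.

Definition energy_barrier (R : realType) S (omega : R) : Prop :=
  forall E s, defects E = S -> error_path E s ->
  exists2 t, (0 < t <= size s)%N
    & omega < #|defects (path_prod (take t s))|%:R.

End Model.

(* Main.v *)
Require Import Defs.
From mathcomp Require Import all_boot all_order all_algebra all_fingroup.
From mathcomp Require Import zify boolp.
From mathcomp Require Import reals exp.

(* Only the cluster of defects of a Pauli operator and its support matter.
   Call a cluster gapped at scale lam if no two of its defects are at distance
   between lam and K lam: it then splits into far apart clusters of diameter at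
   most lam.  A cluster of at most m defects is gapped at one of the scales
   B ^ q, q < m, because each scale where this fails lets us merge two groups
   of defects.  Renormalization: consider a stretch of the history whose
   intermediate configurations are all gapped at scale lam, consecutive ones
   being related by operators supported within lam of the defects.  Erase the
   neutral clusters of the intermediate configurations by local operators.
   Each charged cluster is then transported to a unique nearby charged cluster
   of the next configuration, starts near a defect of the first
   configuration, and stays near its place of birth by the no-strings rule;
   hence a single operator supported within B lam of the defects of the two end
   configurations realizes the whole stretch.  Applied to all the levels, this
   creates S by an operator supported within B ^ m of S.  Its part near S'
   creates S' alone as soon as B ^ m is well below the isolation distance, so
   that S' would be neutral; this forces m to be at least of order ln d. *)

Set Implicit Arguments.
Unset Strict Implicit.
Unset Printing Implicit Defensive.

Import Order.TTheory GRing.Theory Num.Theory.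

(** * Commutation and restriction of Pauli operators *)

Section PauliCommutation.
Variable Q : finType.
Implicit Types E F G : pauli Q.

Definition anticommute1 (p q : pauli1) : bool :=
  [&& p != PI, q != PI & p != q].

Lemma phase1_swap p q :
  phase1 p q = (phase1 q p + (anticommute1 p q).*2%:R)%R.
Proof. by case: p q => [] []; apply/val_inj. Qed.

(** Swapping two distinct non-identity letters adds 2 to the phase in ['Z_4], so only the parity of
    the number of such qubits survives. *)
Lemma anticommuteE E F :
  anticommute E F = \big[addb/false]_q anticommute1 (E.2 q) (F.2 q).
Proof.
set b := \big[_/_]_q _.
have sumE : (\sum_q phase1 (E.2 q) (F.2 q)
    = \sum_q phase1 (F.2 q) (E.2 q) + b.*2%:R :> 'Z_4)%R.
  rewrite (eq_bigr _ (fun q _ => phase1_swap (E.2 q) (F.2 q))) big_split /=.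
  congr (_ + _)%R; rewrite {}/b.
  apply: (big_rec2 (fun (x : 'Z_4) (c : bool) => x = (c.*2%:R)%R)) => // q x c _ ->.
  by case: (anticommute1 _ _) c => [] []; apply/val_inj.
have mul1C p q : mul1 p q = mul1 q p by case: p q => [] [].
rewrite /anticommute -!/(pauli_mul _ _) /mulg /= /pauli_mul /= -pair_eqE /=.
rewrite /pair_eq /= sumE [X in (_ == _ + X)%R]big1 ?addr0; last first.
  by move=> q _; rewrite ffunE.
have -> : [ffun q => mul1 (E.2 q) (F.2 q)] ==
    [ffun q => mul1 ([ffun=> PI] q) ([ffun q0 => mul1 (F.2 q0) (E.2 q0)] q)].
  by apply/eqP/ffunP => q; rewrite !ffunE mul1C.
rewrite andbT [X in _ == X]addrC (addrC E.1) addrA (inj_eq (addrI _)).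
by case: b {sumE}.
Qed.

Lemma anticommuteM G E F :
  anticommute G (E * F)%g = anticommute G E (+) anticommute G F.
Proof.
rewrite !anticommuteE -big_split /=; apply: eq_bigr => q _.
by rewrite ffunE; case: (G.2 q) (E.2 q) (F.2 q) => [] [] [].
Qed.

Lemma anticommute1g G : anticommute G 1%g = false.
Proof.
by rewrite anticommuteE big1 // => q _; rewrite ffunE /anticommute1 eqxx andbF.
Qed.

Definition restrict (P : pred Q) E : pauli Q :=
  (0%R, [ffun q => if P q then E.2 q else PI]).

Lemma anticommute_restrict (P : pred Q) G E :
  (forall q, q \in qsupport G -> q \in qsupport E -> P q) ->
  anticommute G (restrict P E) = anticommute G E.
Proof.
move=> GP; rewrite !anticommuteE; apply: eq_bigr => q _.
rewrite ffunE; case: ifPn => // /negP Pq; rewrite /anticommute1 eqxx /= andbF.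
symmetry; apply/negbTE/negP => /and3P[Gq Eq _].
by apply: Pq; apply: GP; rewrite inE.
Qed.

Lemma anticommute_qsupport G E :
  anticommute G E -> exists2 q, q \in qsupport G & q \in qsupport E.
Proof.
case: (pickP [pred q in qsupport G | q \in qsupport E]) => [q /andP[? ?]|GE].
  by exists q.
rewrite anticommuteE big1 // => q _; have := GE q; rewrite /= !inE /anticommute1.
by do 2 case: eqP => //=.
Qed.

Lemma qsupportM E F : qsupport (E * F)%g \subset qsupport E :|: qsupport F.
Proof.
apply/subsetP => q; rewrite !inE ffunE.
by case: (E.2 q) (F.2 q) => [] [].
Qed.

Lemma qsupport_restrict (P : pred Q) E q :
  (q \in qsupport (restrict P E)) = (q \in qsupport E) && P q.
Proof. by rewrite !inE ffunE; case: ifP; rewrite ?andbT ?andbF ?eqxx. Qed.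

End PauliCommutation.

(** * Distances, balls and cubes on the torus *)

Section Torus.
Variables D L : nat.
Implicit Types (x y z : site D L) (A : {set site D L}).

Lemma cdistC (a b : 'I_L) : cdist a b = cdist b a.
Proof. exact: minnC. Qed.

Lemma cdist_triangle (b a c : 'I_L) : cdist a c <= cdist a b + cdist b c.
Proof.
move: (ltn_ord a) (ltn_ord b) (ltn_ord c); rewrite /cdist => aL bL cL.
rewrite !modsub //; case: (leqP a b) => ?; case: (leqP b c) => ?.
all: case: (leqP b a) => ?; case: (leqP c b) => ?.
all: case: (leqP a c) => ?; case: (leqP c a) => ?; lia.
Qed.

Lemma sdist_leP x y r :
  reflect (forall i, cdist (x i) (y i) <= r) (sdist x y <= r).
Proof.
apply: (iffP (bigmax_leqP _ _ _)) => [h i|h i _]; last exact: h.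
exact: h.
Qed.

Lemma sdistC x y : sdist x y = sdist y x.
Proof. by apply: eq_bigr => i _; rewrite cdistC. Qed.

Lemma sdist_triangle y x z : sdist x z <= sdist x y + sdist y z.
Proof.
apply/sdist_leP => i; apply: leq_trans (cdist_triangle (y i) _ _) _.
by apply: leq_add; move: i; apply/sdist_leP.
Qed.

Lemma sdist_self x : sdist x x = 0.
Proof.
apply/eqP; rewrite -leqn0; apply/sdist_leP => i.
by rewrite /cdist minnn subnKC ?modnn // ltnW.
Qed.

Lemma cube_self x l : 0 < l -> x \in cube x l.
Proof.
by move=> l0; rewrite inE; apply/forallP => i; rewrite subnKC ?modnn // ltnW.
Qed.

Lemma sdist_cube x y z l : 0 < l ->
  y \in cube x l -> z \in cube x l -> sdist y z < l.
Proof.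
move=> l0; rewrite !inE => /forallP xy /forallP xz.
rewrite -(prednK l0) ltnS; apply/sdist_leP => i.
by rewrite -ltnS (prednK l0); apply: cdist_lt (xy i) (xz i).
Qed.

Lemma cube_mono x l l' : l <= l' -> cube x l \subset cube x l'.
Proof.
move=> ll; apply/subsetP => y; rewrite !inE => /forallP xy.
by apply/forallP => i; apply: leq_trans (xy i) ll.
Qed.

Lemma enclosable_mono l l' A : l <= l' -> enclosable l A -> enclosable l' A.
Proof. by move=> ll [x Ax]; exists x; apply: subset_trans Ax (cube_mono x ll). Qed.

Lemma enclosable_sub l A (B : {set site D L}) :
  A \subset B -> enclosable l B -> enclosable l A.
Proof. by move=> AB [x Bx]; exists x; apply: subset_trans Bx. Qed.

Lemma mem_ball r A y : reflect (exists2 x, x \in A & sdist x y <= r) (y \in ball r A).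
Proof. by rewrite inE; apply: (iffP exists_inP). Qed.

(** The lower corner moves down by [k] modulo [L]; [l + 2 * k < L] keeps the enlarged interval from
    wrapping around. *)
Lemma coord_shift (a b c : 'I_L) k l : cdist a b <= k ->
  (a + (L - c)) %% L < l -> l + 2 * k < L ->
  (b + (L - (c + (L - k)) %% L)) %% L < l + 2 * k.
Proof.
move: (ltn_ord a) (ltn_ord b) (ltn_ord c); rewrite /cdist => aL bL cL.
move=> + + lk; set c' := (c + _) %% L.
have c'L : c' < L by rewrite ltn_pmod //; lia.
have := erefl c'; rewrite {1}/c' modsub //; last by lia.
move: c' c'L => c' c'L c'E; rewrite !modsub //.
move: c'E; case: (leqP a b) => ?; case: (leqP b a) => ?.
all: case: (leqP c a) => ?; case: (leqP k c) => ? ?.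
all: case: (leqP c' b) => ?; lia.
Qed.

Lemma ball_enclosable k l A : 0 < L ->
  enclosable l A -> enclosable (l + 2 * k) (ball k A).
Proof.
move=> L0 [x Ax]; case: (leqP L (l + 2 * k)) => lk.
  exists x; apply/subsetP => y _; rewrite inE; apply/forallP => i.
  by apply: leq_trans lk; rewrite ltn_pmod.
exists [ffun i => Ordinal (ltn_pmod (x i + (L - k)) L0)].
apply/subsetP => z /mem_ball[y /(subsetP Ax)]; rewrite !inE => /forallP xy.
move=> /sdist_leP yz; apply/forallP => i; rewrite ffunE /=.
exact: coord_shift (yz i) (xy i) lk.
Qed.

Lemma enclosable1 x : 0 < L -> enclosable 1 [set x].
Proof. by move=> L0; exists x; rewrite sub1set cube_self. Qed.

End Torus.

(** * Creating clusters of defects by localized operators *)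

Section Defects.
Variables (D L : nat) (H : stabilizer_hamiltonian D L).
Hypothesis L_gt0 : 0 < L.
Implicit Types (X Y T W : {set 'I_(nb_gen H)}) (A B : {set site D L}).

Definition gdist (a b : 'I_(nb_gen H)) := sdist (gen_pos a) (gen_pos b).

Lemma gdistC a b : gdist a b = gdist b a.
Proof. exact: sdistC. Qed.

Lemma gdist_triangle b a c : gdist a c <= gdist a b + gdist b c.
Proof. exact: sdist_triangle. Qed.

Lemma gdist_self a : gdist a a = 0.
Proof. exact: sdist_self. Qed.

Definition symdiff X Y := (X :\: Y) :|: (Y :\: X).

Lemma in_symdiff X Y a : (a \in symdiff X Y) = (a \in X) (+) (a \in Y).
Proof. by rewrite !inE; case: (a \in X); case: (a \in Y). Qed.

Definition creatable X A := exists2 E, defects E = X & Defs.support E \subset A.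

(** Distances are measured from the corners [gen_pos], so a qubit of a generator in [X] lies in
    [nbhd X 1]. *)
Definition nbhd X r : {set site D L} :=
  [set y | [exists a in X, sdist (gen_pos a) y <= r]].

Lemma mem_nbhd X r y :
  reflect (exists2 a, a \in X & sdist (gen_pos a) y <= r) (y \in nbhd X r).
Proof. by rewrite inE; apply: (iffP exists_inP). Qed.

Lemma nbhd_near X Y r s :
  (forall a, a \in X -> exists2 b, b \in Y & gdist b a + r <= s) ->
  nbhd X r \subset nbhd Y s.
Proof.
move=> XY; apply/subsetP => y /mem_nbhd[a /XY[b Yb ab] ay].
apply/mem_nbhd; exists b => //; apply: leq_trans ab.
by apply: leq_trans (sdist_triangle (gen_pos a) _ _) _; rewrite leq_add2l.
Qed.

Lemma nbhdS X Y r s : X \subset Y -> r <= s -> nbhd X r \subset nbhd Y s.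
Proof.
move=> /subsetP XY rs; apply: nbhd_near => a /XY Ya.
by exists a; rewrite ?gdist_self.
Qed.

Lemma nbhd_ball X r x k : (forall a, a \in X -> sdist x (gen_pos a) + r <= k) ->
  nbhd X r \subset ball k [set x].
Proof.
move=> Xx; apply/subsetP => y /mem_nbhd[a /Xx ak ay].
apply/mem_ball; exists x; rewrite ?inE //; apply: leq_trans ak.
by apply: leq_trans (sdist_triangle (gen_pos a) _ _) _; rewrite leq_add2l.
Qed.

Lemma ball_nbhd X r a k : a \in X -> k <= r -> ball k [set gen_pos a] \subset nbhd X r.
Proof.
move=> Xa kr; apply/subsetP => y /mem_ball[z]; rewrite inE => /eqP-> ay.
by apply/mem_nbhd; exists a => //; apply: leq_trans ay kr.
Qed.

Lemma gen_cube_near (a : 'I_(nb_gen H)) y : y \in gen_cube a -> sdist (gen_pos a) y <= 1.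
Proof. by apply: sdist_cube => //; apply: cube_self. Qed.

Lemma gen_pos_cube (a : 'I_(nb_gen H)) : gen_pos a \in gen_cube a.
Proof. exact: cube_self. Qed.

Lemma qsite_near (a : 'I_(nb_gen H)) q :
  q \in qsupport (gen a) -> sdist (gen_pos a) (qsite q) <= 1.
Proof. by move=> qa; apply/gen_cube_near/gen_local. Qed.

Lemma defectsM E F :
  defects (E * F)%g = symdiff (defects E) (defects F) :> {set 'I_(nb_gen H)}.
Proof. by apply/setP => a; rewrite in_symdiff !inE anticommuteM. Qed.

Lemma defects1 : defects 1%g = set0 :> {set 'I_(nb_gen H)}.
Proof. by apply/setP => a; rewrite !inE anticommute1g. Qed.

Lemma creatable0 A : creatable set0 A.
Proof.
exists 1%g; first exact: defects1.
by apply/subsetP => y /imsetP[q]; rewrite inE ffunE.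
Qed.

Lemma creatableS X A B : A \subset B -> creatable X A -> creatable X B.
Proof. by move=> AB [E EX EA]; exists E => //; apply: subset_trans AB. Qed.

Lemma creatable_symdiff X Y A :
  creatable X A -> creatable Y A -> creatable (symdiff X Y) A.
Proof.
move=> [E <- /subsetP EA] [F <- /subsetP FA]; exists (E * F)%g; first exact: defectsM.
apply/subsetP => _ /imsetP[q /(subsetP (qsupportM _ _)) + ->].
by rewrite inE => /orP[] qE; [apply: EA|apply: FA]; apply: imset_f.
Qed.

(** Cut the operator down to [nbhd W r]. A generator within [r + 1] of [W] that met a discarded
    qubit would put a point of [T] outside [W] within [2 * r + 2] of [W]; a generator farther away
    does not meet the restricted operator. *)
Lemma creatable_part X T W r : creatable X (nbhd T r) -> X \subset T ->
  (forall a b, a \in W -> b \in T -> b \notin W -> 2 * r + 2 < gdist a b) ->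
  creatable (X :&: W) (nbhd W r).
Proof.
move=> [E EX /subsetP ET] /subsetP XT sep.
exists (restrict (fun q => qsite q \in nbhd W r) E); last first.
  by apply/subsetP => _ /imsetP[q + ->]; rewrite qsupport_restrict => /andP[].
have near_W a w q : w \in W -> gdist w a <= r + 1 ->
    q \in qsupport (gen a) -> q \in qsupport E -> qsite q \in nbhd W r.
  move=> Ww wa qa qE; have /mem_nbhd[b Tb bq] := ET _ (imset_f (@qsite _ _ H) qE).
  case: (boolP (b \in W)) => Wb; first by apply/mem_nbhd; exists b.
  have := sep _ _ Ww Tb Wb; have := qsite_near qa.
  have := gdist_triangle a w b.
  have := sdist_triangle (qsite q) (gen_pos a) (gen_pos b).
  rewrite (sdistC (qsite q)) -/(gdist _ _); lia.
apply/setP => a; rewrite !inE -EX; apply/idP/andP => [aE|[aE aW]].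
  have [q qa] := anticommute_qsupport aE.
  rewrite qsupport_restrict => /andP[qE /mem_nbhd[w Ww wq]].
  have wa : gdist w a <= r + 1.
    apply: leq_trans (sdist_triangle (qsite q) _ _) _.
    by apply: leq_add => //; rewrite sdistC qsite_near.
  have Xa : a \in defects E.
    by rewrite inE -(anticommute_restrict (fun q' => near_W a w q' Ww wa)).
  split; first by move: (Xa); rewrite inE.
  apply/negPn/negP => Wa; have := sep _ _ Ww (XT a _) Wa.
  by rewrite -EX => /(_ Xa); lia.
rewrite anticommute_restrict ?inE // in aE *.
by move=> q; apply: near_W aW _; rewrite gdist_self addn1.
Qed.

Lemma neutral_creatable ltqo X x k :
  creatable X (ball k [set x]) -> 1 + 2 * k <= ltqo -> neutral ltqo X.
Proof.
move=> [E EX Ek] kl; exists E; split=> //.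
apply: enclosable_mono kl _; apply: enclosable_sub Ek _.
exact/ball_enclosable/enclosable1.
Qed.

Lemma sites_ball X x lam : (forall a, a \in X -> sdist x (gen_pos a) <= lam) ->
  sites X \subset ball lam.+1 [set x].
Proof.
move=> Xx; apply/subsetP => y /bigcupP[a Xa /gen_cube_near ay].
apply/mem_ball; exists x; rewrite ?inE //.
by apply: leq_trans (sdist_triangle (gen_pos a) _ _) _; rewrite -addn1 leq_add ?Xx.
Qed.

(** The smallest cube given by [tqo2] has side at most [2 * lam + 3] and meets the cluster, so its
    1-neighbourhood stays within [3 * lam + 3 <= 6 * lam] of [x]. *)
Lemma creatable_local ltqo X x lam : tqo2 H ltqo -> neutral ltqo X -> 0 < lam ->
  (forall a, a \in X -> sdist x (gen_pos a) <= lam) ->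
  creatable X (ball (6 * lam) [set x]).
Proof.
move=> tqo Xn lam0 Xx; case: (set_0Vmem X) => [->|[a Xa]]; first exact: creatable0.
have [y [l [[Xl lmin] [E [EX El]]]]] := tqo X Xn.
exists E => //; apply: subset_trans El _.
have llam : l <= 1 + 2 * lam.+1.
  apply: lmin; apply: enclosable_sub (sites_ball Xx) _.
  exact/ball_enclosable/enclosable1.
have ya : gen_pos a \in cube y l.
  by apply: (subsetP Xl); apply/bigcupP; exists a => //; apply: gen_pos_cube.
(* A cube of side 0 is nonempty only in dimension 0, where the lattice is a single point. *)
case: (posnP l) ya => [->|l0] ya.
  have sL (z : site D L) : z \in cube y 0 -> D = 0.
    rewrite inE => /forallP zy; case: (posnP D) => // D0.
    by have := zy (Ordinal D0).
  have D0 := sL _ ya.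
  apply/subsetP => z _; apply/mem_ball; exists x; rewrite ?inE //.
  by apply/sdist_leP => i; have := ltn_ord i; rewrite [X in _ < X]D0.
apply/subsetP => z /mem_ball[w wy wz]; apply/mem_ball; exists x; rewrite ?inE //.
have := sdist_cube l0 ya wy; have := Xx a Xa.
have := sdist_triangle (gen_pos a) x z; have := sdist_triangle w (gen_pos a) z.
lia.
Qed.

Local Open Scope ring_scope.

(** Both clusters fit in cubes of side [rho = 2 * lam + 3 <= 5 * lam]. The extra [8 * lam] pays for
    the extents of the two cubes, which are thus more than [5 * n * lam >= n * rho] apart and serve
    as anchor regions. *)
Lemma string_neutral (R : realType) (alpha : R) ltqo (n lam k : nat) X Y x y z :
  no_strings H ltqo alpha -> alpha <= n%:R -> (0 < lam)%N ->
  (forall a, a \in X -> sdist x (gen_pos a) <= lam)%N ->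
  (forall a, a \in Y -> sdist y (gen_pos a) <= lam)%N ->
  creatable (symdiff X Y) (ball k [set z]) -> (1 + 2 * k <= ltqo)%N ->
  ((5 * n + 8) * lam < sdist x y)%N -> neutral ltqo X.
Proof.
move=> nostr an lam0 Xx Yy [E EXY Ek] kl far.
set rho := (1 + 2 * lam.+1)%N; have rho_gt0 : (0 < rho)%N by [].
have encl (u : site D L) : enclosable rho (ball lam.+1 [set u]).
  exact/ball_enclosable/enclosable1.
have [u xu] := encl x; have [v yv] := encl y.
have xb (w : site D L) r : w \in ball r [set w].
  by apply/mem_ball; exists w; rewrite ?inE ?sdist_self.
have uv_far s t : s \in cube u rho -> t \in cube v rho ->
    (5 * n * lam < sdist s t)%N.
  move=> us vt.
  have := sdist_cube rho_gt0 (subsetP xu _ (xb _ _)) us.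
  have := sdist_cube rho_gt0 (subsetP yv _ (xb _ _)) vt.
  have := sdist_triangle s x y; have := sdist_triangle t s y.
  by rewrite (sdistC t y) /rho; nia.
have XA a : a \in X -> gen_cube a \subset cube u rho.
  move=> Xa; apply: subset_trans xu; apply: subset_trans (sites_ball Xx).
  exact: bigcup_sup.
have YA a : a \in Y -> gen_cube a \subset cube v rho.
  move=> Ya; apply: subset_trans yv; apply: subset_trans (sites_ball Yy).
  exact: bigcup_sup.
have disj s : s \in cube u rho -> s \in cube v rho -> False.
  by move=> us vs; have := uv_far _ _ us vs; rewrite sdist_self.
(* The successor makes the ratio strictly larger than [n], even when [rho = 5 * lam]. *)
have [] := nostr E (cube u rho) (cube v rho) rho ((5 * n * lam).+1%:R / rho%:R).
- split; [|by exists u|by exists v| |].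
  + apply: enclosable_mono kl _; apply: enclosable_sub Ek _.
    exact/ball_enclosable/enclosable1.
  + apply/pred0P => s /=; apply/negP => /andP[]; exact: disj.
  + apply/bigcupsP => a; rewrite EXY in_symdiff => /addbP.
    case: (boolP (a \in X)) => [Xa _|_ /esym Ya].
      by apply: subset_trans (XA a Xa) (subsetUl _ _).
    by apply: subset_trans (YA a _) (subsetUr _ _); move: Ya => /negPf; case: (a \in Y).
- by move=> s t us vt; rewrite divfK ?pnatr_eq0 // ler_nat uv_far.
- rewrite ltr_pdivlMr ?ltr0n //; apply: (@le_lt_trans _ _ (n%:R * rho%:R)).
    by rewrite ler_wpM2r.
  by rewrite -natrM ltr_nat /rho; nia.
move=> + _; congr neutral; apply/setP => a; rewrite inE EXY in_symdiff.
case: (boolP (a \in X)) => Xa; case: (boolP (a \in Y)) => Ya //=.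
- case: (disj (gen_pos a)).
    exact: subsetP (XA a Xa) _ (gen_pos_cube _).
  exact: subsetP (YA a Ya) _ (gen_pos_cube _).
- exact: XA.
apply/negbTE/negP => /subsetP/(_ _ (gen_pos_cube a)) au.
exact: disj au (subsetP (YA a Ya) _ (gen_pos_cube _)).
Qed.

End Defects.

(** * Chains with a condition on interior points only *)

Inductive chain (T : Type) (R : T -> T -> Prop) (G : T -> Prop) (x : T) : T -> Prop :=
| chain_one y : R x y -> chain R G x y
| chain_rcons z y : chain R G x z -> G z -> R z y -> chain R G x y.

(** Interior points classified under [G'] stay as breakpoints; each stretch between two breakpoints
    has its interior in [G] and becomes one [R'] step. *)
Lemma chain_compress (T : Type) (R R' : T -> T -> Prop) (F G G' : T -> Prop) x y :
  (forall z, F z -> G z \/ G' z) -> (forall z t, chain R G z t -> R' z t) ->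
  chain R F x y -> chain R' G' x y.
Proof.
move=> FG RR' xy.
have glue z t : z = x \/ chain R' G' x z /\ G' z -> chain R G z t -> chain R' G' x t.
  move=> [->|[xz Gz]] zt; first exact/chain_one/RR'.
  exact: chain_rcons xz Gz (RR' _ _ zt).
(* [z] is the last breakpoint before [y], or the start [x]. *)
suff [z []] : exists z, (z = x \/ chain R' G' x z /\ G' z) /\ chain R G z y.
  exact: glue.
elim: xy => [t xt|z t _ [z' [z'x z'z]] Fz zt].
  by exists x; split; [left|apply: chain_one].
case: (FG _ Fz) => Gz.
  by exists z'; split=> //; apply: chain_rcons Gz zt.
exists z; split; last exact: chain_one.
by right; split=> //; apply: glue z'z.
Qed.

(** * Gapped configurations and renormalization of histories *)

Section Renormalization.
Variables (D L : nat) (H : stabilizer_hamiltonian D L).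
Variable n : nat.
Implicit Types (X Y Z T W N S C : {set 'I_(nb_gen H)}) (lam : nat).

(* A gap of 90 makes the partner of a transported cluster unique, 5 n leaves room
   for its total displacement; scale_ratio = 2 gap_ratio + 3 is the loss in
   nongapped_cover. *)
Definition gap_ratio := 5 * n + 90.
Definition scale_ratio := 10 * n + 183.

Definition gapped lam S := [forall a in S, forall b in S,
  (gdist a b <= gap_ratio * lam) ==> (gdist a b <= lam)].

Lemma gappedP lam S : reflect (forall a b : 'I_(nb_gen H), a \in S -> b \in S ->
  gdist a b <= gap_ratio * lam -> gdist a b <= lam) (gapped lam S).
Proof.
apply: (iffP forall_inP) => [h a b /h/forall_inP/[apply]/implyP //|h a Sa].
by apply/forall_inP => b Sb; apply/implyP; apply: h.
Qed.

(* Each level at which S is not gapped lets us drop one centre: two centres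
   close to a pair violating the gap are within the next scale. *)
Lemma nongapped_cover S q :
  (forall p, p < q -> ~~ gapped (scale_ratio ^ p) S) ->
  exists2 C : {set 'I_(nb_gen H)}, #|C| + q <= #|S| &
    forall a : 'I_(nb_gen H), a \in S ->
      exists2 c, c \in C & 2 * gdist a c <= scale_ratio ^ q.
Proof.
elim: q => [_|q IH ng].
  by exists S => [|a Sa]; [rewrite addn0|exists a; rewrite // gdist_self].
have [C Cq CS] := IH (fun p pq => ng p (ltnW pq)).
move: (ng q (ltnSn q)); rewrite /gapped; set lam := scale_ratio ^ q in CS *.
move=> /forall_inPn[a Sa /forall_inPn[b Sb]]; rewrite negb_imply -ltnNge.
move=> /andP[le_ab lt_ab].
have [c Cc ac] := CS a Sa; have [c' Cc' bc'] := CS b Sb.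
have c'c : c' != c.
  apply: contraTneq lt_ab => c'c; rewrite -c'c in ac.
  have := gdist_triangle c' a b; rewrite -leqNgt (gdistC c' b); lia.
exists (C :\ c') => [|x Sx].
  by move: Cq; rewrite (cardsD1 c' C) Cc'; lia.
have lamS : scale_ratio ^ q.+1 = scale_ratio * lam by rewrite expnS.
have [z Cz xz] := CS x Sx; case: (eqVneq z c') => [zc'|zc'].
  exists c; first by rewrite !inE eq_sym c'c Cc.
  have := gdist_triangle c' x c; have := gdist_triangle b c' c.
  have := gdist_triangle a b c; rewrite zc' in xz.
  rewrite (gdistC c' b) (gdistC b a) lamS.
  by move: le_ab; rewrite /scale_ratio /gap_ratio; nia.
exists z; first by rewrite !inE zc'.
by rewrite lamS; apply: leq_trans xz _; rewrite leq_pmull // /scale_ratio; lia.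
Qed.

(** Otherwise [m] failed levels use up all the centres, so [S] is empty and vacuously gapped. *)
Lemma gapped_level S m : 0 < m -> #|S| <= m ->
  exists2 q, q < m & gapped (scale_ratio ^ q) S.
Proof.
move=> m0 Sm; apply: contrapT => ng.
have [p pm|C Cm CS] := @nongapped_cover S m.
  by apply/negP => gp; apply: ng; exists p.
have C0 : C = set0 by apply/eqP; rewrite -cards_eq0; lia.
apply: ng; exists 0 => //; apply/gappedP => a b /CS[c].
by rewrite C0 inE.
Qed.

Hypothesis L_gt0 : 0 < L.
Variables (R : realType) (alpha : R) (ltqo : nat).
Hypothesis alpha_le : (alpha <= n%:R)%R.
Hypothesis local_neutral : tqo2 H ltqo.
Hypothesis nostr : no_strings H ltqo alpha.

Definition link lam X Y := creatable (symdiff X Y) (nbhd (X :|: Y) lam).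

Definition cluster lam S a := [set b in S | gdist a b <= lam].

Definition neutral_part lam S := [set a in S | `[< neutral ltqo (cluster lam S a) >]].

Definition charged_part lam S := S :\: neutral_part lam S.

(** * One renormalization level *)

Section Level.
Variable lam : nat.
Hypothesis lam_gt0 : 0 < lam.
Hypothesis lam_small : 1 + 2 * ((5 * n + 75) * lam) <= ltqo.

Lemma mem_cluster S a b : (b \in cluster lam S a) = (b \in S) && (gdist a b <= lam).
Proof. by rewrite inE. Qed.

Lemma cluster_self S a : a \in S -> a \in cluster lam S a.
Proof. by move=> Sa; rewrite mem_cluster Sa gdist_self. Qed.

(** Two distances of at most [lam] add up to less than the gap, so closeness is transitive and
    clusters are equivalence classes. *)
Lemma gapped_cluster S a b : gapped lam S -> a \in S -> b \in S ->
  gdist a b <= gap_ratio * lam -> cluster lam S a = cluster lam S b.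
Proof.
move=> /gappedP gS Sa Sb /(gS _ _ Sa Sb) ab.
apply/setP => c; rewrite !mem_cluster; case: (boolP (c \in S)) => //= Sc.
have := gdist_triangle a b c; have := gdist_triangle b a c.
have := gS a c Sa Sc; have := gS b c Sb Sc; rewrite (gdistC b a) /gap_ratio.
by move=> *; apply/idP/idP => ?; nia.
Qed.

Lemma gapped_neutral_part S a b : gapped lam S -> a \in S -> b \in S ->
  gdist a b <= gap_ratio * lam -> (b \in neutral_part lam S) = (a \in neutral_part lam S).
Proof.
by move=> gS Sa Sb ab; rewrite !inE Sa Sb (gapped_cluster gS Sa Sb ab).
Qed.

(** A union of whole clusters that can be erased locally. The empty set qualifies too, which covers
    the ends of a chain, not assumed gapped. *)
Definition removable S N := [/\ N \subset S,
  forall a b, a \in N -> b \in S -> gdist a b <= gap_ratio * lam ->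
    b \in N /\ gdist a b <= lam
  & creatable N (nbhd N (6 * lam))].

Lemma removable0 S : removable S set0.
Proof. by split; [exact: sub0set|move=> a b; rewrite inE|exact: creatable0]. Qed.

(** Peel off one cluster at a time; by the gap, clusters that meet coincide. *)
Lemma neutral_clusters_creatable S X : gapped lam S -> X \subset S ->
    (forall a, a \in X -> cluster lam S a \subset X /\ neutral ltqo (cluster lam S a)) ->
  creatable X (nbhd X (6 * lam)).
Proof.
move=> gS; have [k] := ubnP #|X|; elim: k X => // k IH X Xk XS Xn.
case: (set_0Vmem X) => [->|[a Xa]]; first exact: creatable0.
have [aX an] := Xn a Xa; set A := cluster lam S a in aX an.
have Sa := subsetP XS _ Xa.
have -> : creatable X = creatable (symdiff A (X :\: A)).
  congr creatable; apply/setP => b; rewrite in_symdiff in_setD.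
  by case: (boolP (b \in A)) => //= /(subsetP aX) ->.
apply: creatable_symdiff.
  apply: creatableS (creatable_local L_gt0 local_neutral an lam_gt0 _).
    exact: ball_nbhd Xa (leqnn _).
  by move=> b; rewrite mem_cluster => /andP[].
apply: creatableS (nbhdS (subsetDl X A) (leqnn _)) _.
apply: IH.
- apply: leq_trans (_ : #|X| <= _) => //; apply: proper_card.
  rewrite properE subsetDl /=; apply/subsetPn; exists a => //.
  by rewrite inE cluster_self.
- exact: subset_trans (subsetDl _ _) XS.
move=> b; rewrite in_setD => /andP[Ab Xb]; have [bX bn] := Xn b Xb; split=> //.
apply/subsetP => c cb; rewrite in_setD (subsetP bX) // andbT.
move: cb; rewrite mem_cluster => /andP[Sc bc].
apply: contra Ab; rewrite !mem_cluster Sc (subsetP XS) //= => ac.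
apply: (gappedP _ _ gS) => //; first exact: (subsetP XS).
have := gdist_triangle c a b; rewrite (gdistC c b) /gap_ratio; nia.
Qed.

Lemma removable_neutral S : gapped lam S -> removable S (neutral_part lam S).
Proof.
move=> gS; have NS : neutral_part lam S \subset S.
  by apply/subsetP => a; rewrite inE => /andP[].
split=> // [a b Na Sb ab|].
  have Sa := subsetP NS _ Na.
  by rewrite (gapped_neutral_part gS Sa Sb ab); split=> //; apply: (gappedP _ _ gS).
apply: (neutral_clusters_creatable gS NS) => a Na; split; last first.
  by move: Na; rewrite inE => /andP[_ /asboolP].
apply/subsetP => b; rewrite mem_cluster => /andP[Sb ab].
rewrite (gapped_neutral_part gS (subsetP NS _ Na) Sb) //.
by apply: leq_trans ab _; rewrite leq_pmull // /gap_ratio; lia.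
Qed.

(** Defects of [B] too close to [A] to be separated from it by [creatable_part], together with their
    clusters. *)
Definition attached (A B : {set 'I_(nb_gen H)}) := [set b in B | [exists c in A,
  [exists b0 in B, (gdist c b0 <= 14 * lam) && (gdist b0 b <= lam)]]].

Lemma attachedP (A B : {set 'I_(nb_gen H)}) b :
  reflect (b \in B /\ exists c b0,
    [/\ c \in A, b0 \in B, gdist c b0 <= 14 * lam & gdist b0 b <= lam])
    (b \in attached A B).
Proof.
rewrite inE; apply: (iffP andP).
  move=> [Bb /exists_inP[c Ac /exists_inP[b0 Bb0 /andP[cb0 b0b]]]].
  by split=> //; exists c, b0.
move=> [Bb [c [b0 [Ac Bb0 cb0 b0b]]]]; split=> //.
by apply/exists_inP; exists c => //; apply/exists_inP; exists b0; rewrite ?cb0.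
Qed.

(** If [w] and [b] were close, a point [b] of [N] would be within [29 * lam] of a surviving defect
    of [S], against the gap; a point of [N'] would itself be attached, directly or through its
    cluster. *)
Lemma attached_separated S S' N N' w b : removable S N -> removable S' N' ->
    w \in (S :\: N) :|: attached (S :\: N) N' -> b \in N :|: N' ->
    b \notin attached (S :\: N) N' ->
  14 * lam < gdist w b.
Proof.
move=> [NS gN _] [NS' gN' _] Ww + nb; rewrite ltnNge => NNb; apply/negP => wb.
have notC c : c \in S :\: N -> b \in N -> gdist b c <= gap_ratio * lam -> False.
  by rewrite in_setD => /andP[/negP Nc Sc] Nb /(gN _ _ Nb Sc)[].
move: NNb Ww; rewrite !in_setU => /orP[Nb|Nb] /orP[Cw|/attachedP].
- by apply: notC Cw Nb _; rewrite gdistC /gap_ratio; nia.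
- move=> [_ [c [b0 [Cc _ cb0 b0w]]]]; apply: notC Cc Nb _.
  have := gdist_triangle w b c; have := gdist_triangle b0 w c.
  rewrite (gdistC b w) (gdistC b0 c) (gdistC w b0) /gap_ratio; nia.
- move/negP: nb; apply; apply/attachedP; split=> //.
  by exists w, b; rewrite gdist_self.
move=> [Nw [c [b0 [Cc Nb0 cb0 b0w]]]].
have [||_ b0b] := gN' b0 b Nb0; first exact: (subsetP NS').
  by have := gdist_triangle w b0 b; rewrite /gap_ratio; nia.
by move/negP: nb; apply; apply/attachedP; split=> //; exists c, b0.
Qed.

(** Compose the link with the two erasing operators, then discard what acts far from the surviving
    defects. *)
Lemma link_removable S S' N N' : removable S N -> removable S' N' -> link lam S S' ->
  creatable (symdiff (S :\: N) (S' :\: N')) (nbhd ((S :\: N) :|: (S' :\: N')) (21 * lam)).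
Proof.
move=> rN rN' SS'; have [NS _ crN] := rN; have [NS' _ crN'] := rN'.
set C := S :\: N; set C' := S' :\: N'; set T := S :|: S'.
have crT : creatable (symdiff C C') (nbhd T (6 * lam)).
  have -> : symdiff C C' = symdiff (symdiff S S') (symdiff N N').
    apply/setP => a; rewrite !in_symdiff !in_setD.
    have /implyP := subsetP NS a; have /implyP := subsetP NS' a.
    by case: (a \in N); case: (a \in N'); case: (a \in S); case: (a \in S').
  apply: creatable_symdiff.
    by apply: creatableS SS'; apply: nbhdS => //; lia.
  apply: creatable_symdiff.
    apply: creatableS crN; apply: nbhdS => //.
    exact: subset_trans NS (subsetUl _ _).
  apply: creatableS crN'; apply: nbhdS => //.
  exact: subset_trans NS' (subsetUr _ _).
(* The separation [14 * lam] suffices for supports of radius [6 * lam], since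
   [12 * lam + 2 <= 14 * lam]. *)
pose W := C :|: C' :|: attached C N' :|: attached C' N.
have sep a b : a \in W -> b \in T -> b \notin W -> 2 * (6 * lam) + 2 < gdist a b.
  move=> Wa Tb; rewrite /W !in_setU !negb_or -!andbA => /and4P[Cb C'b nb n'b].
  have NNb : b \in N :|: N'.
    move: Tb Cb C'b; rewrite !in_setU !in_setD.
    by case: (b \in N) => //=; case: (b \in N') => //=; case: (b \in S) => //= ->.
  apply: (@leq_trans (14 * lam).+1); first by lia.
  move: Wa; rewrite /W !in_setU => /orP[/orP[/orP[]|]|] Wa.
  - by apply: (attached_separated rN rN') => //; rewrite in_setU Wa.
  - by apply: (attached_separated rN' rN); rewrite // 1?setUC // in_setU Wa ?orbT.
  - by apply: (attached_separated rN rN') => //; rewrite in_setU Wa orbT.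
  - by apply: (attached_separated rN' rN); rewrite // 1?setUC // in_setU Wa ?orbT.
have := creatable_part L_gt0 crT _ sep.
have CT : C :|: C' \subset T.
  by apply: setUSS; apply: subsetDl.
have DC : symdiff C C' \subset C :|: C'.
  by apply/subsetP => a; rewrite in_symdiff in_setU; case: (a \in C).
rewrite (setIidPl _); last first.
  by apply: subset_trans DC _; rewrite /W -!setUA setUA subsetUl.
(* Attached defects are within [(14 + 1) * lam] of surviving ones; the support adds [6 * lam]. *)
move=> /(_ (subset_trans DC CT)); apply: creatableS; apply: nbhd_near => a.
move=> /setUP[/setUP[Ca|/attachedP]|/attachedP].
- by exists a => //; rewrite gdist_self; lia.
- move=> [_ [c [b [Cc _ cb ba]]]]; exists c; first by rewrite in_setU Cc.
  by have := gdist_triangle b c a; lia.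
- move=> [_ [c [b [Cc _ cb ba]]]]; exists c; first by rewrite in_setU Cc orbT.
  by have := gdist_triangle b c a; lia.
Qed.

(** Otherwise the cluster of [a] is more than [44 * lam >= 2 * (21 * lam) + 2] away from all other
    defects of [S] and [C'], and cutting it out shows that it is neutral. *)
Lemma partner_near S S' C' a : gapped lam S' -> C' \subset S' ->
    (forall b, b \in C' -> cluster lam S' b \subset C') ->
    creatable (symdiff S C') (nbhd (S :|: C') (21 * lam)) ->
    a \in C' -> charged ltqo (cluster lam S' a) ->
  exists2 b, b \in S & gdist b a <= 45 * lam.
Proof.
move=> gS' CS' clC' crSC' Ca ach; apply: contrapT => far; apply: ach.
have {}far b : b \in S -> 45 * lam < gdist b a.
  by move=> Sb; rewrite ltnNge; apply/negP => ba; apply: far; exists b.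
set W := cluster lam S' a; have WC : W \subset C' by exact: clC'.
apply: (neutral_creatable L_gt0 (x := gen_pos a) (k := 22 * lam)); last first.
  by move: lam_small; lia.
have -> : W = symdiff S C' :&: W.
  apply/setP => b; rewrite in_setI in_symdiff; case: (boolP (b \in W)) => Wb.
    rewrite (subsetP WC _ Wb) andbT addbT; apply/esym/negP => /far.
    by move: Wb; rewrite mem_cluster gdistC => /andP[_]; lia.
  by rewrite andbF.
apply: creatableS (creatable_part L_gt0 crSC' _ _).
- apply: nbhd_ball => b; rewrite mem_cluster -/(gdist a b).
  by move=> /andP[_]; lia.
- apply/subsetP => b; rewrite in_symdiff in_setU.
  by case: (b \in S); case: (b \in C').
move=> b c; rewrite mem_cluster in_setU => /andP[Sb ab] /orP[/far|C'c].
  have := gdist_triangle b c a; rewrite (gdistC c b) (gdistC b a); lia.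
rewrite mem_cluster (subsetP CS') //= => ac; rewrite ltnNge; apply: contra ac => bc.
apply: (gappedP _ _ gS'); rewrite ?(subsetP CS') //.
by have := gdist_triangle b a c; rewrite /gap_ratio; nia.
Qed.

(** A defect of [C] within [44 * lam] of the pair of clusters is within [(45 + 1 + 44) * lam] of
    [b], hence in its cluster by the gap; likewise for [C'] and [a]. The pair is thus isolated
    enough to be cut out. *)
Lemma partner_link S S' C C' a b : gapped lam S -> gapped lam S' ->
    C \subset S -> (forall c, c \in C -> cluster lam S c \subset C) ->
    C' \subset S' -> (forall c, c \in C' -> cluster lam S' c \subset C') ->
    creatable (symdiff C C') (nbhd (C :|: C') (21 * lam)) ->
    b \in C -> a \in C' -> gdist b a <= 45 * lam ->
  creatable (symdiff (cluster lam S' a) (cluster lam S b))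
    (nbhd (cluster lam S b :|: cluster lam S' a) (21 * lam)).
Proof.
move=> /gappedP gS /gappedP gS' CS clC CS' clC' crCC' Cb Ca ba.
set A := cluster lam S' a; set B := cluster lam S b; set W := B :|: A.
have inB w c : w \in W -> c \in C -> gdist w c <= 44 * lam -> c \in B.
  move=> + Cc wc; have Sc := subsetP CS _ Cc; have Sb := subsetP CS _ Cb.
  rewrite in_setU !mem_cluster Sc /= => W'; apply: gS => //.
  have := gdist_triangle w b c; have := gdist_triangle a b w.
  by case/orP: W' => /andP[_]; rewrite /gap_ratio; nia.
have inA w c : w \in W -> c \in C' -> gdist w c <= 44 * lam -> c \in A.
  move=> + Cc wc; have Sc := subsetP CS' _ Cc; have Sa := subsetP CS' _ Ca.
  rewrite in_setU !mem_cluster Sc /= => W'; apply: gS' => //.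
  have := gdist_triangle w a c; have := gdist_triangle b a w; rewrite (gdistC a b).
  by case/orP: W' => /andP[_]; rewrite /gap_ratio; nia.
have -> : symdiff A B = symdiff C C' :&: W.
  apply/setP => c; rewrite in_setI !in_symdiff.
  case: (boolP (c \in W)) => [Wc|]; last first.
    by rewrite in_setU negb_or => /andP[/negbTE-> /negbTE->]; rewrite andbF.
  rewrite andbT addbC; congr (_ (+) _).
    apply/idP/idP => [/(subsetP (clC _ Cb))//|Cc].
    by apply: inB Wc Cc _; rewrite gdist_self.
  apply/idP/idP => [/(subsetP (clC' _ Ca))//|Cc].
  by apply: inA Wc Cc _; rewrite gdist_self.
apply: (creatable_part L_gt0 crCC') => [|w c Ww].
  apply/subsetP => c; rewrite in_symdiff in_setU.
  by case: (c \in C); case: (c \in C').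
rewrite !in_setU negb_or => /orP[Cc|Cc] /andP[cB cA]; rewrite ltnNge.
  by apply: contra cB => wc; apply: inB Ww Cc _; lia.
by apply: contra cA => wc; apply: inA Ww Cc _; lia.
Qed.

Lemma charged_part_sub S : charged_part lam S \subset S.
Proof. exact: subsetDl. Qed.

Lemma charged_partP S a : a \in charged_part lam S ->
  charged ltqo (cluster lam S a).
Proof.
by rewrite !inE negb_and => /andP[+ Sa]; rewrite Sa /= => /asboolPn.
Qed.

Lemma cluster_charged_part S a : gapped lam S -> a \in charged_part lam S ->
  cluster lam S a \subset charged_part lam S.
Proof.
move=> gS; rewrite in_setD => /andP[aN Sa]; apply/subsetP => b.
rewrite mem_cluster in_setD => /andP[Sb ab]; rewrite Sb andbT.
rewrite (gapped_neutral_part gS Sa Sb) //.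
by apply: leq_trans ab _; rewrite leq_pmull // /gap_ratio; lia.
Qed.

(* O is the cluster, born near X, that moved to the charged cluster of a; by the
   no-strings rule, the total displacement stays bounded. *)
Definition has_origin X Z a := exists o x (O : {set 'I_(nb_gen H)}),
  [/\ x \in X, gdist x o <= 45 * lam,
      forall b, b \in O -> gdist o b <= lam,
      gdist o a <= (5 * n + 8) * lam
    & creatable (symdiff (cluster lam Z a) O)
        (ball ((5 * n + 75) * lam) [set gen_pos o])].

(** The radius around [X] does not depend on the number of steps; this uniformity lets a whole
    stretch collapse into one link. *)
Definition traced X Z :=
  creatable (symdiff X (charged_part lam Z)) (nbhd X ((5 * n + 74) * lam)) /\
  forall a, a \in charged_part lam Z -> has_origin X Z a.

(** Each charged cluster of [Z] has a defect of [X] nearby and serves as its own origin. *)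
Lemma traced_first X Z : gapped lam Z -> link lam X Z -> traced X Z.
Proof.
move=> gZ XZ; have := link_removable (removable0 X) (removable_neutral gZ) XZ.
rewrite setD0 => crXZ.
have near a : a \in charged_part lam Z -> exists2 x, x \in X & gdist x a <= 45 * lam.
  move=> Ca; apply: (partner_near gZ (charged_part_sub Z) _ crXZ Ca).
    by move=> b; apply: cluster_charged_part.
  exact: charged_partP.
split=> [|a Ca].
  apply: creatableS crXZ; apply: nbhd_near => a.
  rewrite in_setU => /orP[Xa|/near[x Xx xa]].
    by exists a; rewrite // gdist_self; nia.
  by exists x => //; nia.
have [x Xx xa] := near a Ca; exists a, x, (cluster lam Z a).
split=> //; first by move=> b; rewrite mem_cluster => /andP[].
  by rewrite gdist_self.
have -> : symdiff (cluster lam Z a) (cluster lam Z a) = set0; last exact: creatable0.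
by apply/setP => b; rewrite in_symdiff addbb inE.
Qed.

Lemma traced_near X Z a : traced X Z -> a \in charged_part lam Z ->
  exists2 x, x \in X & gdist x a <= (5 * n + 53) * lam.
Proof.
move=> [_ tr] /tr[o [x [O [Xx xo _ oa _]]]]; exists x => //.
by have := gdist_triangle o x a; nia.
Qed.

(** Compose the past of the partner in [Z] with the move to [Z']. A displacement beyond the bound
    would make this a string segment and the cluster neutral, so the bound is restored instead of
    growing at each step. *)
Lemma traced_step X Z Z' : gapped lam Z -> gapped lam Z' ->
  traced X Z -> link lam Z Z' -> traced X Z'.
Proof.
move=> gZ gZ' trZ ZZ'; have [crX tr] := trZ.
have crZ := link_removable (removable_neutral gZ) (removable_neutral gZ') ZZ'.
have tr' a : a \in charged_part lam Z' -> has_origin X Z' a.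
  move=> Ca; have [b Cb ba] : exists2 b, b \in charged_part lam Z & gdist b a <= 45 * lam.
    apply: (partner_near gZ' (charged_part_sub _) _ crZ Ca).
      by move=> b; apply: cluster_charged_part.
    exact: charged_partP.
  have [o [x [O [Xx xo Oo ob crO]]]] := tr b Cb; exists o, x, O.
  have crba : creatable (symdiff (cluster lam Z' a) (cluster lam Z b))
      (ball ((5 * n + 75) * lam) [set gen_pos o]).
    apply: creatableS (partner_link gZ gZ' (charged_part_sub _) _
      (charged_part_sub _) _ crZ Cb Ca ba).
    (* In units of [lam]: [5 * n + 8] to [b], 45 to [a], 1 across the cluster, 21 for the
       support. *)
    + apply: nbhd_ball => c; rewrite -/(gdist o c) in_setU !mem_cluster => cba.
      have := gdist_triangle b o c; have := gdist_triangle a b c.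
      by case/orP: cba => /andP[_]; nia.
    + by move=> c; apply: cluster_charged_part.
    by move=> c; apply: cluster_charged_part.
  have crOa : creatable (symdiff (cluster lam Z' a) O)
      (ball ((5 * n + 75) * lam) [set gen_pos o]).
    have -> : symdiff (cluster lam Z' a) O = symdiff
        (symdiff (cluster lam Z' a) (cluster lam Z b)) (symdiff (cluster lam Z b) O).
      by apply/setP => c; rewrite !in_symdiff -addbA addKb.
    exact: creatable_symdiff.
  split=> //; rewrite leqNgt; apply/negP => far; apply: (charged_partP Ca).
  apply: (string_neutral L_gt0 nostr alpha_le lam_gt0 _ _ crOa lam_small (x := gen_pos a)).
  - by move=> c; rewrite mem_cluster => /andP[].
  - exact: Oo.
  by rewrite sdistC.
split=> //.
have -> : symdiff X (charged_part lam Z') = symdiff (symdiff X (charged_part lam Z))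
    (symdiff (charged_part lam Z) (charged_part lam Z')).
  by apply/setP => c; rewrite !in_symdiff -addbA addKb.
(* Charged defects are within [(5 * n + 53) * lam] of [X]; the support adds [21 * lam]. *)
apply: creatable_symdiff => //; apply: creatableS crZ; apply: nbhd_near => a.
rewrite in_setU => /orP[/(traced_near trZ)[x Xx xa]|/tr'[o [x [O [Xx xo _ oa _]]]]].
  by exists x => //; nia.
by exists x => //; have := gdist_triangle o x a; nia.
Qed.

(** Trace the charged clusters up to the last interior configuration; the final step erases nothing
    of [Y], which need not be gapped. *)
Lemma chain_link X Y : chain (link lam) (gapped lam) X Y -> link (scale_ratio * lam) X Y.
Proof.
move=> XY; suff : link lam X Y \/ exists Z, [/\ gapped lam Z, traced X Z & link lam Z Y].
  move=> [XY1|[Z [gZ trZ ZY]]].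
    by apply: creatableS XY1; apply: nbhdS => //; rewrite leq_pmull // /scale_ratio; lia.
  have crZ := link_removable (removable_neutral gZ) (removable0 Y) ZY.
  rewrite setD0 in crZ; have [crX _] := trZ; rewrite /link.
  have -> : symdiff X Y = symdiff (symdiff X (charged_part lam Z))
      (symdiff (charged_part lam Z) Y).
    by apply/setP => c; rewrite !in_symdiff -addbA addKb.
  apply: creatable_symdiff.
    by apply: creatableS crX; apply: nbhdS; rewrite ?subsetUl // /scale_ratio; nia.
  apply: creatableS crZ; apply: nbhd_near => a.
  rewrite in_setU => /orP[/(traced_near trZ)[x Xx xa]|Ya].
    by exists x; rewrite ?in_setU ?Xx // /scale_ratio; nia.
  by exists a; rewrite ?in_setU ?Ya ?orbT // gdist_self /scale_ratio; nia.
elim: XY => [Z XZ|Z Z' _ IH gZ ZZ']; first by left.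
right; exists Z; split=> //; case: IH => [XZ|[Z1 [gZ1 trZ1 Z1Z]]].
  exact: traced_first.
exact: traced_step trZ1 Z1Z.
Qed.

End Level.

(** At stage [p] links have range [scale_ratio ^ p] and interior configurations are gapped at a
    level at least [p]; compressing those of level [p] gives the next stage. At stage [m] no
    interior configuration is left. *)
Lemma chain_levels m X Y : scale_ratio ^ m <= ltqo ->
  chain (link 1) (fun Z => exists2 q, q < m & gapped (scale_ratio ^ q) Z) X Y ->
  link (scale_ratio ^ m) X Y.
Proof.
move=> ml XY; have B0 : 0 < scale_ratio by rewrite /scale_ratio; lia.
suff : chain (link (scale_ratio ^ m))
    (fun Z => exists2 q, m <= q < m & gapped (scale_ratio ^ q) Z) X Y.
  by case=> // Z y _ [q]; lia.
have lev p : p <= m -> chain (link (scale_ratio ^ p))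
    (fun Z => exists2 q, p <= q < m & gapped (scale_ratio ^ q) Z) X Y.
  elim: p => [_|p IH pm]; first by rewrite expn0.
  apply: (chain_compress (G := gapped (scale_ratio ^ p))) (IH (ltnW pm)) => [Z [q /andP[]]|Z Z' ZZ'].
    rewrite leq_eqVlt => /predU1P[<-|pq] qm gZ; [by left|right].
    by exists q; rewrite ?pq.
  rewrite expnS; apply: chain_link _ _ ZZ'; first by rewrite expn_gt0 B0.
  (* For [lam = scale_ratio ^ p], [1 + 2 * ((5 * n + 75) * lam) <= scale_ratio * lam <= ltqo]. *)
  have := leq_pexp2l B0 pm; rewrite expnS.
  have : 0 < scale_ratio ^ p by rewrite expn_gt0 B0.
  by move: ml; rewrite /scale_ratio; nia.
exact: lev.
Qed.

End Renormalization.

(** * From error paths to chains of links *)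

Section ErrorPaths.
Variables (D L : nat) (H : stabilizer_hamiltonian D L).
Hypothesis L_gt0 : 0 < L.
Implicit Types (S X Y : {set 'I_(nb_gen H)}) (e : pauli (qubit H)).

(** An error creating no defect is replaced by the identity. Otherwise its qubit belongs to a
    flipped generator, which is a defect either before or after the error. *)
Lemma link_single_qubit X e : is_single_qubit e ->
  link 1 X (symdiff (defects e) X).
Proof.
move=> /existsP[q /existsP[p /andP[_ /eqP eE]]]; rewrite /link.
have -> : symdiff X (symdiff (defects e) X) = defects e.
  by apply/setP => a; rewrite !in_symdiff addbCA addbb addbF.
case: (set_0Vmem (defects e)) => [->|[a ae]]; first exact: creatable0.
exists e => //; apply/subsetP => _ /imsetP[q' q'e ->].
have onlyq q1 : q1 \in qsupport e -> q1 = q.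
  by rewrite eE inE ffunE; case: (eqVneq q1 q) => //; rewrite eqxx.
have [q1 q1a /onlyq q1q] : exists2 q1, q1 \in qsupport (gen a) & q1 \in qsupport e.
  by apply: anticommute_qsupport; rewrite inE in ae.
apply/mem_nbhd; exists a.
  by rewrite in_setU in_symdiff ae; case: (a \in X).
by rewrite (onlyq _ q'e) -q1q qsite_near.
Qed.

Lemma path_prod_rcons (Q : finType) (s : seq (pauli Q)) (e : pauli Q) :
  path_prod (rcons s e) = (e * path_prod s)%g.
Proof. by rewrite /path_prod rev_rcons big_cons. Qed.

Lemma error_path_chain (F : {set 'I_(nb_gen H)} -> Prop) (s : seq (pauli (qubit H))) t :
  all (@is_single_qubit _) s ->
  (forall u, 0 < u <= size s -> F (defects (path_prod (take u s)))) ->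
  0 < t <= size s -> chain (link 1) F set0 (defects (path_prod (take t s))).
Proof.
move=> /(all_nthP 1%g) s1 Fs; elim: t => // t IH ts.
have ts' : t < size s by case/andP: ts.
rewrite (take_nth 1%g) // path_prod_rcons defectsM.
have step X : link 1 X (symdiff (defects (nth 1%g s t)) X).
  exact/link_single_qubit/s1.
case: (posnP t) => [t0|t0].
  apply: chain_one; rewrite [in path_prod _]t0 take0 [path_prod _]big_nil defects1.
  exact: step.
have t0s : 0 < t <= size s by rewrite t0 ltnW.
exact: chain_rcons (IH t0s) (Fs _ t0s) (step _).
Qed.

(** Cut out the part of the operator near [S']; a cube of side [r.+1] thickened by [lam] encloses
    it. *)
Lemma isolated_neutral ltqo S S' r lam :
    creatable S (nbhd S lam) -> S' \subset S ->
    (forall a b, a \in S' -> b \in S -> b \notin S' -> 2 * lam + 2 < gdist a b) ->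
    has_diameter (sites S') r -> r.+1 + 2 * lam <= ltqo ->
  neutral ltqo S'.
Proof.
move=> crS S'S sep [x [S'x _]] rl.
have := creatable_part L_gt0 crS (subxx _) sep; rewrite (setIidPr S'S).
move=> [E ES' El]; exists E; split=> //; apply: enclosable_mono rl _.
apply: enclosable_sub El _; apply: enclosable_sub (ball_enclosable (A := sites S') _ L_gt0 _).
  apply/subsetP => y /mem_nbhd[a S'a ay]; apply/mem_ball; exists (gen_pos a) => //.
  by apply/bigcupP; exists a => //; apply: gen_pos_cube.
by exists x.
Qed.

Lemma neutral0 ltqo : neutral ltqo (set0 : {set 'I_(nb_gen H)}).
Proof.
have [E E0 Es] := creatable0 H set0; exists E; split=> //.
exists [ffun=> Ordinal L_gt0]; exact: subset_trans Es (sub0set _).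
Qed.

End ErrorPaths.

(** * The logarithmic lower bound on the energy barrier *)

Local Open Scope ring_scope.

Theorem theorem2 (R : realType) (D : nat) (alpha beta : R) :
  (0 < D)%N -> 1 <= alpha -> 0 < beta ->
  exists2 c : R, 0 < c &
    forall (L : nat) (H : stabilizer_hamiltonian D L) (ltqo : nat),
      (0 < L)%N -> L%:R `^ beta <= ltqo%:R ->
      tqo1 H ltqo -> tqo2 H ltqo -> no_strings H ltqo alpha ->
    forall (S S' : {set 'I_(nb_gen H)}) (r : nat) (d : R),
      neutral ltqo S -> S' \subset S -> charged ltqo S' ->
      has_diameter (sites S') r -> isolated S S' d ->
      r%:R + d < ltqo%:R ->
      energy_barrier S (c * ln d).
Proof.
move=> _ alpha1 _; set n := Num.bound alpha.
have alpha_le : alpha <= n%:R.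
  by apply/ltW/archi_boundP/le_trans/alpha1.
have [B BE] : exists B, B = scale_ratio n by exists (scale_ratio n).
have B_gt2 : (2 < B)%N by rewrite BE /scale_ratio addnC.
have B_gt0 : (0 < B)%N by apply: ltnW (ltnW B_gt2).
have B1 : 1 < (B ^ 2)%:R :> R by rewrite ltr1n -(exp1n 2) ltn_exp2r // ltnW.
have lnB : 0 < ln ((B ^ 2)%:R : R) by rewrite ln_gt0.
(* With this constant, at most [m <= c * ln d] defects give [B ^ (2 * m) <= d]; the square leaves
   room for [3 * B ^ m <= d]. *)
exists (ln (B ^ 2)%:R)^-1; first by rewrite invr_gt0.
move=> L H ltqo L_gt0 _ _ local_neutral nostr S S' r d _ S'S S'ch S'r iso rd.
move=> E s ES [s1 sE]; apply: contrapT => low.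
have {}low t : (0 < t <= size s)%N ->
    #|defects (path_prod (take t s))|%:R <= (ln (B ^ 2)%:R)^-1 * ln d.
  by move=> ts; rewrite leNgt; apply/negP => lt; apply: low; exists t.
(* The empty cluster is neutral, so [S] is nonempty; hence the path is nonempty and [m] below is
   positive. *)
have S0 : (0 < #|S|)%N.
  rewrite lt0n; apply/negP => /eqP/cards0_eq S0; apply: S'ch.
  have -> : S' = set0 by apply/eqP; rewrite -subset0 -S0.
  exact: neutral0.
have s0 : (0 < size s)%N.
  case: s sE {s1 low} => // sE; move: S0.
  by rewrite -ES -sE [path_prod _]big_nil defects1 cards0.
have take_s : defects (path_prod (take (size s) s)) = S by rewrite take_size sE.
pose m := (\max_(t < (size s).+1 | (0 < t)%N) #|defects (path_prod (take t s))|)%N.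
have le_m t : (0 < t <= size s)%N -> (#|defects (path_prod (take t s))| <= m)%N.
  move=> /andP[t0 ts]; have ts' : (t < (size s).+1)%N by [].
  exact: (@leq_bigmax_cond _ _ (fun t : 'I__ => #|defects (path_prod (take t s))|) (Ordinal ts')).
have m0 : (0 < m)%N.
  by apply: leq_trans S0 _; rewrite -take_s; apply: le_m; rewrite s0 leqnn.
have m_d : ((B ^ 2) ^ m)%:R <= d.
  have md : m%:R <= (ln (B ^ 2)%:R)^-1 * ln d.
    rewrite /m; apply: (big_ind (fun k => k%:R <= (ln (B ^ 2)%:R)^-1 * ln d)).
    - by apply: le_trans (low (size s) _); rewrite ?ler0n // s0 leqnn.
    - by move=> x y xd yd; rewrite /maxn; case: ifP.
    by move=> t t0; apply: low; rewrite t0 -ltnS ltn_ord.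
  rewrite mulrC ler_pdivlMr // in md.
  have lnd : 0 < ln d by apply: lt_le_trans md; rewrite mulr_gt0 ?ltr0n.
  (* [ln] takes the default value 0 at nonpositive reals, so [0 < ln d] forces [0 < d]. *)
  have d0 : 0 < d.
    by rewrite ltNge; apply/negP => /ln0 d0; rewrite d0 ltxx in lnd.
  rewrite -ler_ln ?posrE // ?ltr0n ?expn_gt0 ?B_gt0 //.
  by rewrite mulr_natl in md; rewrite natrX lnXn // (lt_trans _ B1).
have scale_le : (B ^ m * 3 <= (B ^ 2) ^ m)%N.
  rewrite -expnM mul2n -addnn expnD leq_mul2l -(prednK m0) expnS orbC.
  by rewrite (leq_trans B_gt2) // leq_pmulr // expn_gt0 B_gt0.
have Bm_gt1 : (1 < B ^ m)%N by rewrite -(exp1n m) ltn_exp2r // ltnW.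
have m_d3 : (B ^ m * 3)%:R <= d by apply: le_trans m_d; rewrite ler_nat.
have rB : (r + B ^ m * 3 < ltqo)%N.
  by rewrite -(ltr_nat R) natrD; apply: le_lt_trans rd; rewrite lerD2l.
(* Both size conditions follow from [2 * B ^ m + 2 <= 3 * B ^ m <= d] and [r + 3 * B ^ m < ltqo]. *)
apply: S'ch; apply: (isolated_neutral L_gt0 (S := S) (r := r) (lam := (B ^ m)%N)) => //; last first.
- by move: rB Bm_gt1; move: (B ^ m)%N; clear; lia.
- move=> a b S'a Sb S'b; rewrite -(ltr_nat R).
  have := iso b (gen_pos b) (gen_pos a).
  rewrite in_setD S'b Sb gen_pos_cube // sdistC => /(_ isT isT).
  have /[swap]/[apply] : gen_pos a \in sites S'.
    by apply/bigcupP; exists a => //; apply: gen_pos_cube.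
  apply: le_lt_trans; apply: le_trans m_d3; rewrite ler_nat.
  by move: Bm_gt1; move: (B ^ m)%N; clear; lia.
pose F (Z : {set 'I_(nb_gen H)}) :=
  exists2 q, (q < m)%N & gapped n (scale_ratio n ^ q) Z.
have F_path u : (0 < u <= size s)%N -> F (defects (path_prod (take u s))).
  by move=> us; apply: gapped_level m0 (le_m _ us).
have := error_path_chain (t := size s) s1 F_path.
rewrite s0 leqnn take_s => /(_ isT).
move/(chain_levels L_gt0 alpha_le local_neutral nostr); rewrite -BE /link set0U.
have -> : symdiff set0 S = S by apply/setP => a; rewrite in_symdiff inE.
by apply; move: rB; move: (B ^ m)%N; clear; lia.
Qed.
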